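(* Let $f:\mathbb{R}^n\to\mathbb{R}$ be continuously differentiable and convex, $A\in\mathbb{R}^{m\times n}$, $b\in\mathbb{R}^m$. Suppose $f$ is $\mu$-strongly convex with $l$-Lipschitz gradient ($lI\succeq\nabla^2f(x)\succeq\mu I$ wherever $\nabla^2f(x)$ is defined) and $A$ has full row rank with $\sigma I\succeq AA^T\succeq\kappa I$, where $\mu,l,\sigma,\kappa>0$. Let $\eta>0$, $\alpha>0$ satisfy $2\eta>l\alpha$, and let $$\tilde L(u,y):=f(u-\alpha A^Ty)+\eta y^T(Au-b)-\eta\alpha\|A^Ty\|^2 .$$ Then the preconditioned primal-dual dynamics $$\dot u=-\nabla f(u-\alpha A^Ty)-\eta A^Ty,$$ $$\dot y=\big[-\alpha A\nabla f(u-\alpha A^Ty)+\eta(Au-b)-2\eta\alpha AA^Ty\big]_y^+$$ are globally exponentially stable: writing $w=(u,y)$, given the unique saddle point $w_\star$ of $\tilde L$ on $\mathbb{R}^n\times\mathbb{R}^m_{\ge0}$ and any initial point $w(0)\in\mathbb{R}^n\times\mathbb{R}^m_{\ge0}$, $$\|w(t)-w_\star\|\le\|w(0)-w_\star\|e^{-ct}$$ holds (for all $t\ge0$) with the rate $c=\min\{\mu,(2\eta\alpha-l\alpha^2)\kappa\}>0$.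
   Context: The dynamics are designed to solve $\min_xf(x)$ subject to $Ax-b\le0$, with dual variable $y\in\mathbb{R}^m_{\ge0}$; $\tilde L$ arises from $L(x,y)=f(x)+\eta y^T(Ax-b)$ by the change of variables $u=x+\alpha A^Ty$. For $y\in\mathbb{R}^m_{\ge0}$ and $s\in\mathbb{R}^m$, $[s]_y^+$ is defined componentwise by $([s]_y^+)_j=s_j$ if $y_j>0$ and $([s]_y^+)_j=\max\{s_j,0\}$ if $y_j=0$. Saddle point of $\tilde L$: $\tilde L(u_\star,y)\le\tilde L(u_\star,y_\star)\le\tilde L(u,y_\star)$ for all $u\in\mathbb{R}^n$, $y\in\mathbb{R}^m_{\ge0}$. Solutions are in the Carathéodory sense (absolutely continuous, satisfying the equations for almost every $t$, with $y(t)\ge0$). *)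

(* Defs.v *)
From HB Require Import structures.
From mathcomp Require Import all_boot all_order all_algebra.
From mathcomp Require Import all_classical all_reals all_analysis.

Set Implicit Arguments.
Unset Strict Implicit.
Unset Printing Implicit Defensive.

Import Order.TTheory GRing.Theory Num.Theory.
Import numFieldNormedType.Exports.

Local Open Scope classical_set_scope.
Local Open Scope ring_scope.

Definition dot (R : realType) (n : nat) (x y : 'cV[R]_n) : R :=
  (x^T *m y) 0 0.

(* The library norm `|x| on matrices is the sup norm; it only serves for
   topological notions, where the choice of a norm is irrelevant. *)
Definition norm2 (R : realType) (n : nat) (x : 'cV[R]_n) : R :=
  Num.sqrt (dot x x).

Definition grad (R : realType) (n : nat) (f : 'cV[R]_n -> R) (x : 'cV[R]_n)
    : 'cV[R]_n :=
  \col_i 'D_(delta_mx i 0) f x.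

Definition C1 (R : realType) (n : nat) (f : 'cV[R]_n -> R) : Prop :=
  (forall x, differentiable f x) /\ continuous (grad f).

Definition convex (R : realType) (n : nat) (f : 'cV[R]_n -> R) : Prop :=
  convex_function [set: convex_lmodType 'cV[R]_n] f.

Definition strongly_convex (R : realType) (n : nat) (mu : R)
    (f : 'cV[R]_n -> R) : Prop :=
  convex (fun x => f x - mu / 2 * norm2 x ^+ 2).

Definition lipschitz_grad (R : realType) (n : nat) (l : R)
    (f : 'cV[R]_n -> R) : Prop :=
  forall x y, norm2 (grad f x - grad f y) <= l * norm2 (x - y).

(* The Loewner order, used on symmetric matrices only. *)
Definition loewner_le (R : realType) (n : nat) (P Q : 'M[R]_n) : Prop :=
  forall x : 'cV[R]_n, 0 <= dot x ((Q - P) *m x).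

Definition nonneg (R : realType) (m : nat) (y : 'cV[R]_m) : Prop :=
  forall j, 0 <= y j 0.

(* [s]_y^+, meaningful for y >= 0, so that the second branch is y_j = 0. *)
Definition proj_plus (R : realType) (m : nat) (y s : 'cV[R]_m) : 'cV[R]_m :=
  \col_j (if 0 < y j 0 then s j 0 else Num.max (s j 0) 0).

Definition Ltilde (R : realType) (n m : nat) (f : 'cV[R]_n -> R)
    (A : 'M[R]_(m, n)) (b : 'cV[R]_m) (eta alpha : R)
    (u : 'cV[R]_n) (y : 'cV[R]_m) : R :=
  f (u - alpha *: (A^T *m y)) + eta * dot y (A *m u - b)
  - eta * alpha * norm2 (A^T *m y) ^+ 2.

Definition saddle_point (R : realType) (n m : nat)
    (L : 'cV[R]_n -> 'cV[R]_m -> R) (us : 'cV[R]_n) (ys : 'cV[R]_m) : Prop :=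
  nonneg ys /\
  forall (u : 'cV[R]_n) (y : 'cV[R]_m), nonneg y ->
    L us y <= L us ys /\ L us ys <= L u ys.

(* Absolute continuity on [a, b]: finite families of non-overlapping
   subintervals are lists of pairs of endpoints. *)
Definition abs_continuous (R : realType) (V : normedModType R) (a b : R)
    (g : R -> V) : Prop :=
  forall eps : R, 0 < eps -> exists2 delta : R, 0 < delta &
    forall s : seq (R * R),
      all (fun i => [&& a <= i.1, i.1 <= i.2 & i.2 <= b]) s ->
      pairwise (fun i j => (i.2 <= j.1) || (j.2 <= i.1)) s ->
      \sum_(i <- s) (i.2 - i.1) < delta ->
      \sum_(i <- s) `|g i.2 - g i.1| < eps.

(* Caratheodory solutions on [0, +oo[; the values of u and y at negative
   times are irrelevant. *)
Definition is_solution (R : realType) (n m : nat) (f : 'cV[R]_n -> R)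
    (A : 'M[R]_(m, n)) (b : 'cV[R]_m) (eta alpha : R)
    (u : R -> 'cV[R]_n) (y : R -> 'cV[R]_m) : Prop :=
  [/\ forall T : R, 0 < T -> abs_continuous 0 T u /\ abs_continuous 0 T y,
      forall t : R, 0 <= t -> nonneg (y t)
    & {ae lebesgue_measure, forall t : R, 0 < t ->
        is_derive (t : R^o) 1 u
          (- grad f (u t - alpha *: (A^T *m y t)) - eta *: (A^T *m y t)) /\
        is_derive (t : R^o) 1 y
          (proj_plus (y t)
            (- alpha *: (A *m grad f (u t - alpha *: (A^T *m y t)))
             + eta *: (A *m u t - b)
             - (2 * eta * alpha) *: (A *m A^T *m y t)))}].

(* Main.v *)
Require Import Defs.
From HB Require Import structures.
From mathcomp Require Import all_boot all_order all_algebra.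
From mathcomp Require Import all_classical all_reals all_analysis.
From mathcomp Require Import ring lra.

Set Implicit Arguments.
Unset Strict Implicit.
Unset Printing Implicit Defensive.

Import Order.TTheory GRing.Theory Num.Theory.
Import numFieldNormedType.Exports.

Local Open Scope classical_set_scope.
Local Open Scope ring_scope.

(** The opposite of the field [(- grad_u L~, grad_y L~)] is strongly monotone with
    constant [c]: with [x = u - alpha A^T y] and [p = A^T dy], the pairing of the
    field's increment with the increment [(du, dy)] is
    [- <dx, dg> - 2 alpha <p, dg> - 2 eta alpha |p|^2], where [dg] is the
    increment of the gradient of [f]; as [du = dx + alpha p],
    the inequality [grad_cocoercive] bounds this by
    [- mu |du|^2 - (2 eta alpha - l alpha^2) |p|^2], and [|p|^2 >= kappa |dy|^2].
    Saddle points are the solutions of the variational inequality of this field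
    on [R^n * R^m_{>=0}], which has exactly one solution by strong monotonicity
    and Lipschitz continuity.  The projection [_]^+_y only decreases
    [<y - y*, _>], so along a solution [V = |w - w*|^2] satisfies [V' <= - 2 c V]
    almost everywhere, and the absolutely continuous function [e^(2ct) V] does
    not increase. *)

(** * The Euclidean inner product and norm on columns *)

Section Dot.
Variable R : realType.

Lemma dotE n (x y : 'cV[R]_n) : dot x y = \sum_i x i 0 * y i 0.
Proof. by rewrite /dot mxE; apply: eq_bigr => i _; rewrite mxE. Qed.

Lemma dotC n (x y : 'cV[R]_n) : dot x y = dot y x.
Proof. by rewrite !dotE; apply: eq_bigr => i _; rewrite mulrC. Qed.

Lemma dotDr n (x y z : 'cV[R]_n) : dot x (y + z) = dot x y + dot x z.
Proof. by rewrite /dot mulmxDr mxE. Qed.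

Lemma dotDl n (x y z : 'cV[R]_n) : dot (y + z) x = dot y x + dot z x.
Proof. by rewrite !(dotC _ x) dotDr. Qed.

Lemma dotZr n a (x y : 'cV[R]_n) : dot x (a *: y) = a * dot x y.
Proof. by rewrite /dot -scalemxAr mxE. Qed.

Lemma dotZl n a (x y : 'cV[R]_n) : dot (a *: x) y = a * dot x y.
Proof. by rewrite dotC dotZr dotC. Qed.

Lemma dotNr n (x y : 'cV[R]_n) : dot x (- y) = - dot x y.
Proof. by rewrite -scaleN1r dotZr mulN1r. Qed.

Lemma dotNl n (x y : 'cV[R]_n) : dot (- x) y = - dot x y.
Proof. by rewrite dotC dotNr dotC. Qed.

Lemma dot0r n (x : 'cV[R]_n) : dot x 0 = 0.
Proof. by rewrite -(scale0r 0) dotZr mul0r. Qed.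

Lemma dot0l n (x : 'cV[R]_n) : dot 0 x = 0.
Proof. by rewrite dotC dot0r. Qed.

Definition dot_linear := (dotDl, dotDr, dotNl, dotNr, dotZl, dotZr).

Lemma dot_ge0 n (x : 'cV[R]_n) : 0 <= dot x x.
Proof. by rewrite dotE sumr_ge0 // => i _; rewrite -expr2 sqr_ge0. Qed.

Lemma dot_le0 n (x : 'cV[R]_n) : dot x x <= 0 -> x = 0.
Proof.
move=> x_le0; have x0 : dot x x == 0 by rewrite eq_le x_le0 dot_ge0.
apply/colP => i; rewrite mxE; apply/eqP; rewrite -sqrf_eq0 expr2.
move: x0; rewrite dotE psumr_eq0 => [/allP/(_ i)|j _]; last first.
  by rewrite -expr2 sqr_ge0.
by rewrite mem_index_enum; apply.
Qed.

Lemma dot_mulmxr m n (A : 'M[R]_(m, n)) x y :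
  dot x (A *m y) = dot (A^T *m x) y.
Proof. by rewrite /dot mulmxA trmx_mul trmxK. Qed.

Lemma dot_col_mx m n (x x' : 'cV[R]_m) (y y' : 'cV[R]_n) :
  dot (col_mx x y) (col_mx x' y') = dot x x' + dot y y'.
Proof. by rewrite /dot tr_col_mx mul_row_col mxE. Qed.

Lemma norm2_ge0 n (x : 'cV[R]_n) : 0 <= norm2 x.
Proof. exact: sqrtr_ge0. Qed.

Lemma norm2_sqr n (x : 'cV[R]_n) : norm2 x ^+ 2 = dot x x.
Proof. by rewrite sqr_sqrtr ?dot_ge0. Qed.

Lemma dotDD_le n (x y : 'cV[R]_n) :
  dot (x + y) (x + y) <= 2 * dot x x + 2 * dot y y.
Proof.
have := dot_ge0 (x - y); rewrite !dot_linear (dotC y x); lra.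
Qed.

(** Expand the square of [norm2 y *: x - norm2 x *: y], which is nonnegative, and divide by twice
    the product of the norms; zero vectors are treated apart. *)
Lemma cauchy_schwarz n (x y : 'cV[R]_n) : dot x y <= norm2 x * norm2 y.
Proof.
have [x0|x0] := eqVneq (norm2 x) 0.
  have -> : x = 0 by apply: dot_le0; rewrite -norm2_sqr x0 expr0n.
  by rewrite dot0l mulr_ge0 // norm2_ge0.
have nx_gt0 : 0 < norm2 x by rewrite lt_def x0 norm2_ge0.
rewrite -(ler_pM2l nx_gt0) -(ler_pM2l (@ltr0n R 2)).
have [ny0|ny0] := eqVneq (norm2 y) 0.
  have -> : y = 0 by apply: dot_le0; rewrite -norm2_sqr ny0 expr0n.
  by rewrite dot0r !mulr0 !mulr_ge0 ?norm2_ge0 ?ltW.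
have ny_gt0 : 0 < norm2 y by rewrite lt_def ny0 norm2_ge0.
rewrite -(ler_pM2l ny_gt0).
have := dot_ge0 (norm2 y *: x - norm2 x *: y).
rewrite !dot_linear (dotC y x) -!norm2_sqr.
move: (norm2 x) (norm2 y) (dot x y) => a b d; nra.
Qed.

End Dot.

(** * Quadratic bounds from strong convexity and from a Lipschitz gradient *)

Section Gradient.
Variables (R : realType) (n : nat) (f : 'cV[R]_n -> R).
Hypothesis f_diff : forall x, differentiable f x.

Lemma derive_grad x v : 'D_v f x = dot (grad f x) v.
Proof.
rewrite deriveE // dotE {1}[v]matrix_sum_delta linear_sum.
apply: eq_bigr => i _; rewrite big_ord1 linearZ /= mxE -deriveE //.
by rewrite mulrC.
Qed.

Lemma is_derive_line b v (t : R) :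
  is_derive t (1 : R) (fun s : R => f (b + s *: v)) (dot (grad f (b + t *: v)) v).
Proof.
have E : (fun h : R => h^-1 *: (f (b + (h *: (1 : R) + t) *: v) - f (b + t *: v)))
  = (fun h : R => h^-1 *: (f (h *: v + (b + t *: v)) - f (b + t *: v))).
  apply/funext => h; congr (_ *: (f _ - _)).
  by rewrite scalerDl /GRing.scale /= mulr1 addrCA.
apply: DeriveDef.
  rewrite /derivable /= E.
  exact: (@diff_derivable _ _ _ f (b + t *: v) v).
by rewrite -derive_grad /derive /= E.
Qed.

Section Lower.
Variable mu : R.
Hypothesis f_cvx : strongly_convex mu f.

(** Strong convexity bounds the secant slopes [q t] of [f] from [b] towards [a]; as [t] tends to [0]
    from the right, they converge to the directional derivative. *)
Lemma strongly_convex_grad a b :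
  f b + dot (grad f b) (a - b) + mu / 2 * dot (a - b) (a - b) <= f a.
Proof.
pose q := fun t : R => t^-1 *: (f (t *: (a - b) + b) - f b).
have secant (t : R) : 0 < t -> t < 1 ->
    q t <= f a - f b - mu / 2 * (1 - t) * dot (a - b) (a - b).
  move=> t0 t1.
  have t01 : 0 <= t <= 1 by rewrite (ltW t0) (ltW t1).
  have /= := f_cvx (Itv01 (ltW t0) (ltW t1)) (mem_setT a) (mem_setT b).
  rewrite !convRE /= /conv /= /unstable.onem => h.
  rewrite /q /GRing.scale /= ler_pdivrMl //.
  have -> : t *: (a - b) + b = t *: a + (1 - t) *: b.
    by rewrite scalerBr scalerBl scale1r addrAC addrA.
  move: h; rewrite !norm2_sqr !dot_linear (dotC b a).
  move: (f _) (f a) (f b) (dot a a) (dot a b) (dot b b) => x y z c d e.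
  lra.
have qcvg : q t @[t --> 0^'+] --> dot (grad f b) (a - b).
  rewrite -derive_grad.
  exact/cvg_dnbhs_at_right/diff_derivable.
have rcvg : f a - f b - mu / 2 * (1 - t) * dot (a - b) (a - b) @[t --> 0^'+]
    --> f a - f b - mu / 2 * (1 - 0) * dot (a - b) (a - b).
  apply: cvg_at_right_filter.
  apply: cvgB; first exact: cvg_cst.
  apply: cvgMl; apply: cvgMr; apply: cvgB; [exact: cvg_cst|exact: cvg_id].
have : dot (grad f b) (a - b)
    <= f a - f b - mu / 2 * (1 - 0) * dot (a - b) (a - b).
  apply: ler_cvg_to qcvg rcvg _.
  near=> t; apply: secant; near: t.
    exact: nbhs_right_gt.
  exact: nbhs_right_lt.
lra.
Unshelve. all: by end_near. Qed.
End Lower.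

Section Upper.
Variable l : R.
Hypothesis f_lip : lipschitz_grad l f.

(** Up to the constant [f b], [h] is [f] along the segment minus the claimed upper bound.
    Cauchy-Schwarz and the Lipschitz bound make its derivative nonpositive on the unit interval, so
    [h 1 <= h 0]. *)
Lemma descent a b :
  f a <= f b + dot (grad f b) (a - b) + l / 2 * dot (a - b) (a - b).
Proof.
pose v := a - b.
pose h := fun t : R => f (b + t *: v) - (t * dot (grad f b) v
  + t ^+ 2 * (l / 2 * dot v v)).
have dh (t : R) : is_derive t (1 : R) h
    (dot (grad f (b + t *: v)) v
     - (dot (grad f b) v + 2 * t * (l / 2 * dot v v))).
  have df := is_derive_line b v t.
  rewrite /h; apply: is_derive_eq.
  rewrite !scaler0 !add0r /GRing.scale /= !mulr1 /=. ring.
have : h 1 <= h 0.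
  apply: (@ler0_derive1_le_cc R h 0 1) => //; rewrite ?in_itv /= ?lexx ?ler01 //.
  - move=> t; rewrite in_itv /= => /andP[t0 _].
    have [_] := dh t; rewrite derive1E => ->.
    have := cauchy_schwarz (grad f (b + t *: v) - grad f b) v.
    rewrite dot_linear dotNl => cs.
    have := f_lip (b + t *: v) b; rewrite addrAC subrr add0r => lip.
    have nv := norm2_ge0 v.
    rewrite -[dot v v]norm2_sqr.
    have nt : norm2 (t *: v) = t * norm2 v.
      rewrite /norm2 !dot_linear mulrA sqrtrM ?mulr_ge0 ?ltW // -expr2.
      by rewrite sqrtr_sqr ger0_norm ?ltW.
    move: lip cs; rewrite nt; move: (norm2 _) (norm2 v) nv => x y; nra.
  - apply: derivable_within_continuous => t _; by have [] := dh t.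
rewrite /h scale1r scale0r addr0 /v [b + _]addrC subrK; lra.
Qed.
End Upper.
End Gradient.

(** * The saddle operator: monotonicity, and saddle points as solutions of a variational
    inequality *)

Section Saddle.
Variables (R : realType) (n m : nat) (f : 'cV[R]_n -> R).
Variables (A : 'M[R]_(m, n)) (b : 'cV[R]_m) (mu l eta alpha : R).
Hypothesis f_low : forall x z,
  f z + dot (grad f z) (x - z) + mu / 2 * dot (x - z) (x - z) <= f x.
Hypothesis f_up : forall x z,
  f x <= f z + dot (grad f z) (x - z) + l / 2 * dot (x - z) (x - z).

(* Comparing the two quadratic bounds of [f] at [z + v] and at [x - v] gives,
   for C2 functions, what the factorization [dg = H (z - x)] by an averaged
   Hessian [mu I <= H <= l I] would give. *)
Lemma grad_cocoercive x z v :
  mu * dot (z - x + v) (z - x + v) - l * dot v v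
  <= dot (grad f z - grad f x) (z - x) + 2 * dot (grad f z - grad f x) v.
Proof.
have h1 := le_trans (f_low (z + v) x) (f_up (z + v) z).
have h2 := le_trans (f_low (x - v) z) (f_up (x - v) x).
move: h1 h2; have -> : z + v - z = v by rewrite addrAC subrr add0r.
have -> : x - v - x = - v by rewrite addrAC subrr add0r.
have -> : z + v - x = z - x + v by rewrite addrAC.
have -> : x - v - z = - (z - x + v) by rewrite opprD opprB addrAC.
move: (grad f z) (grad f x) (f x) (f z) (z - x) => gz gx fx fz d.
rewrite !dot_linear; lra.
Qed.

(** With [grad_y] below, the partial gradients of [Ltilde] in closed form; [Ltilde_shift_u] and
    [Ltilde_shift_y] compute the exact first-order remainders. *)
Definition grad_u (u : 'cV[R]_n) (y : 'cV[R]_m) : 'cV[R]_n :=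
  grad f (u - alpha *: (A^T *m y)) + eta *: (A^T *m y).

Definition grad_y (u : 'cV[R]_n) (y : 'cV[R]_m) : 'cV[R]_m :=
  - alpha *: (A *m grad f (u - alpha *: (A^T *m y)))
  + eta *: (A *m u - b) - (2 * eta * alpha) *: (A *m A^T *m y).

Let dprimal (u u' : 'cV[R]_n) (y y' : 'cV[R]_m) :
  u - alpha *: (A^T *m y) - (u' - alpha *: (A^T *m y'))
  = u - u' - alpha *: (A^T *m (y - y')).
Proof. by rewrite mulmxBr scalerBr opprD opprK addrACA opprB [- _ + _]addrC. Qed.

Lemma grad_uB u y u' y' : grad_u u y - grad_u u' y' =
  grad f (u - alpha *: (A^T *m y)) - grad f (u' - alpha *: (A^T *m y'))
  + eta *: (A^T *m (y - y')).
Proof. by rewrite /grad_u mulmxBr scalerBr opprD addrACA. Qed.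

Lemma grad_yB u y u' y' : grad_y u y - grad_y u' y' =
  - alpha *: (A *m (grad f (u - alpha *: (A^T *m y))
                    - grad f (u' - alpha *: (A^T *m y'))))
  + eta *: (A *m (u - u')) - (2 * eta * alpha) *: (A *m (A^T *m (y - y'))).
Proof.
apply/colP => i; rewrite /grad_y -!mulmxA !mulmxBr !mxE; ring.
Qed.

Section Monotone.
Variable kappa : R.
Hypothesis kappa_le : loewner_le kappa%:M (A *m A^T).
Hypothesis eta_alpha : l * alpha <= 2 * eta.
Hypothesis alpha_ge0 : 0 <= alpha.

Lemma loewner_trmx y : kappa * dot y y <= dot (A^T *m y) (A^T *m y).
Proof.
have := kappa_le y.
by rewrite mulmxBl mul_scalar_mx dotDr dotNr dotZr -mulmxA (dot_mulmxr A) subr_ge0.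
Qed.

Lemma saddle_operator_monotone c u y u' y' :
  c <= mu -> c <= (2 * eta * alpha - l * alpha ^+ 2) * kappa ->
  c * (dot (u - u') (u - u') + dot (y - y') (y - y')) <=
  dot (u - u') (grad_u u y - grad_u u' y')
  - dot (y - y') (grad_y u y - grad_y u' y').
Proof.
move=> c1 c2; rewrite grad_uB grad_yB.
(* The shift [v = alpha A^T dy] turns the increment of [u - alpha A^T y] back into [du]. The two
   cross terms [eta <du, A^T dy>] cancel in the pairing. *)
have := grad_cocoercive (u' - alpha *: (A^T *m y')) (u - alpha *: (A^T *m y))
  (alpha *: (A^T *m (y - y'))).
rewrite dprimal subrK; have := loewner_trmx (y - y').
have := dot_ge0 (u - u'); have := dot_ge0 (y - y').
move: (grad f _ - grad f _) (u - u') (y - y') => dg d e E0 D0.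
rewrite !(dotDr, dotDl, dotNl, dotNr, dotZr, dotZl) !(dot_mulmxr A).
move: (A^T *m e) => p; rewrite (dotC p d) (dotC p dg) (dotC d dg).
move: (dot e e) (dot d d) E0 D0 => Y U Y0 U0 kP.
have : 0 <= (2 * eta * alpha - l * alpha ^+ 2) * (dot p p - kappa * Y).
  by rewrite mulr_ge0 ?subr_ge0 // expr2 mulrA ler_wpM2r.
have := ler_wpM2r U0 c1; have := ler_wpM2r Y0 c2; lra.
Qed.

End Monotone.

Local Notation L := (Ltilde f A b eta alpha).

(** Apart from the [f] term, [Ltilde] is affine in [u], so only the remainder of [f] is left. *)
Lemma Ltilde_shift_u u y d : L (u + d) y - L u y - dot (grad_u u y) d =
  f (u - alpha *: (A^T *m y) + d) - f (u - alpha *: (A^T *m y))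
  - dot (grad f (u - alpha *: (A^T *m y))) d.
Proof.
rewrite /Ltilde /grad_u [u + d - _]addrAC !norm2_sqr mulmxDr !dot_linear.
by rewrite !(dot_mulmxr A); ring.
Qed.

(** The convex remainder of [f] competes with [- eta alpha |A^T d|^2]; the former is at most
    [l alpha^2 / 2 |A^T d|^2], so [l alpha <= 2 eta] makes the sum nonpositive. *)
Lemma Ltilde_shift_y u y d : L u (y + d) - L u y - dot (grad_y u y) d =
  f (u - alpha *: (A^T *m y) - alpha *: (A^T *m d))
  - f (u - alpha *: (A^T *m y))
  + alpha * dot (grad f (u - alpha *: (A^T *m y))) (A^T *m d)
  - eta * alpha * dot (A^T *m d) (A^T *m d).
Proof.
rewrite /Ltilde /grad_y mulmxDr scalerDr opprD addrA.
rewrite !norm2_sqr !dot_linear -mulmxA !(dotC _ d) !(dot_mulmxr A).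
rewrite (dotC (A^T *m d) (A^T *m y)) (dotC (A^T *m d) (grad f _)).
by ring.
Qed.

Hypotheses (mu_ge0 : 0 <= mu) (l_gt0 : 0 < l).
Hypotheses (alpha_gt0 : 0 < alpha) (eta_gt0 : 0 < eta).
Hypothesis eta_alpha : l * alpha <= 2 * eta.

Lemma saddle_pointP us ys : saddle_point L us ys <->
  [/\ nonneg ys, grad_u us ys = 0 &
      forall y, nonneg y -> dot (grad_y us ys) (y - ys) <= 0].
Proof.
split=> [[ys0 sad]|[ys0 gu0 gy0]]; split => //.
- apply: dot_le0; move gE: (grad_u us ys) => g.
  (* A gradient step of length [1 / l] lowers [Ltilde] by at least [|g|^2 / (2 l)], which
     contradicts minimality in [u] unless [g = 0]. *)
  have [_] := sad (us - l^-1 *: g) ys ys0.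
  have := Ltilde_shift_u us ys (- (l^-1 *: g)); rewrite gE.
  have := f_up (us - alpha *: (A^T *m ys) - l^-1 *: g) (us - alpha *: (A^T *m ys)).
  have -> : forall x w : 'cV[R]_n, x - w - x = - w.
    by move=> x w; rewrite addrAC subrr add0r.
  rewrite !dot_linear !mulrN !opprK.
  have -> : l / 2 * (l^-1 * (l^-1 * dot g g)) = l^-1 * dot g g / 2.
    by field; rewrite gt_eqF.
  move=> h1 h2 h3; have : l^-1 * dot g g <= 0 by lra.
  by rewrite pmulr_rle0 ?invr_gt0.
- move=> y y0; rewrite leNgt; apply/negP.
  have : forall t : R, 0 < t <= 1 -> nonneg (ys + t *: (y - ys)).
    move=> t /andP[t0 t1] j; rewrite !mxE; have := ys0 j; have := y0 j.
    by move: (y _ _) (ys _ _) => a c; nra.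
  move: (y - ys) => d yt; move DE: (dot _ d) => D D0.
  (* If the slope [D] towards [y] were positive, moving by [t d] would raise [Ltilde] by at least
     [t D - t^2 P], the remainder of [f] being nonnegative. The chosen [t] lies in []0, 1]] and has
     [t P < D], so the gain is positive. *)
  pose P := eta * alpha * dot (A^T *m d) (A^T *m d).
  have P0 : 0 <= P by rewrite !mulr_ge0 ?dot_ge0 // ltW.
  pose t := D / (P + D).
  have PD : 0 < P + D by lra.
  have t0 : 0 < t by rewrite divr_gt0.
  have t1 : t <= 1 by rewrite ler_pdivrMr // mul1r; lra.
  have tP : t * P < D by rewrite mulrAC ltr_pdivrMr // ltr_pM2l //; lra.
  have [|+ _] := sad us (ys + t *: d); first by apply: yt; rewrite t0.
  have := Ltilde_shift_y us ys (t *: d); rewrite dotZr DE -!scalemxAr.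
  have := f_low (us - alpha *: (A^T *m ys) - alpha *: (t *: (A^T *m d)))
    (us - alpha *: (A^T *m ys)).
  have -> : forall x w : 'cV[R]_n, x - w - x = - w.
    by move=> x w; rewrite addrAC subrr add0r.
  set q := dot (- _) _.
  have : 0 <= mu / 2 * q by rewrite mulr_ge0 ?divr_ge0 ?dot_ge0.
  rewrite !(dotNr, dotZr, dotZl) => h1 h2 h3 h4.
  have : t * D <= t * (t * P) by rewrite /P; lra.
  by rewrite ler_pM2l // leNgt tP.
(* Conversely, the remainder in [y] is nonpositive by [f_up] and [eta_alpha], and the one in [u] is
   nonnegative by [f_low]. *)
- move=> u y y0; split.
    have := Ltilde_shift_y us ys (y - ys); rewrite [ys + _]addrC subrK.
    have := gy0 y y0.
    have := f_up (us - alpha *: (A^T *m ys) - alpha *: (A^T *m (y - ys)))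
      (us - alpha *: (A^T *m ys)).
    have -> : forall x w : 'cV[R]_n, x - w - x = - w.
      by move=> x w; rewrite addrAC subrr add0r.
    rewrite !dot_linear.
    have : l * alpha * (alpha * dot (A^T *m (y - ys)) (A^T *m (y - ys)))
        <= 2 * eta * (alpha * dot (A^T *m (y - ys)) (A^T *m (y - ys))).
      by rewrite ler_wpM2r // mulr_ge0 ?dot_ge0 // ltW.
    lra.
  have := Ltilde_shift_u us ys (u - us); rewrite [us + _]addrC subrK gu0 dot0l.
  have := f_low (us - alpha *: (A^T *m ys) + (u - us)) (us - alpha *: (A^T *m ys)).
  have -> : forall x w : 'cV[R]_n, x + w - x = w.
    by move=> x w; rewrite addrAC subrr add0r.
  have : 0 <= mu / 2 * dot (u - us) (u - us).
    by rewrite mulr_ge0 ?divr_ge0 ?dot_ge0.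
  lra.
Qed.

End Saddle.

(** * Completeness of matrix spaces, fixed points of Euclidean contractions, and variational
    inequalities *)

HB.instance Definition _ (R : realType) m n :=
  Uniform_isComplete.Build 'M[R]_(m, n) (@mx_complete R m n).

Section FixedPoint.
Variable R : realType.

Lemma normr_sqr_le_dot n (x : 'cV[R]_n) : `|x| ^+ 2 <= dot x x.
Proof.
rewrite -norm2_sqr ler_sqr ?nnegrE ?norm2_ge0 //.
rewrite [leLHS]/Num.Def.normr /= mx_normrE.
apply: bigmax_le => [|[i j] _]; first exact: norm2_ge0.
rewrite -ler_sqr ?nnegrE ?norm2_ge0 // norm2_sqr real_normK ?num_real //=.
rewrite dotE ord1 (bigD1 i) //= -expr2 lerDl sumr_ge0 // => k _.
by rewrite -expr2 sqr_ge0.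
Qed.

Lemma dot_le_normr_sqr n (x : 'cV[R]_n) : dot x x <= n%:R * `|x| ^+ 2.
Proof.
have -> : n%:R * `|x| ^+ 2 = \sum_(i < n) `|x| ^+ 2.
  by rewrite mulr_natl sumr_const card_ord.
rewrite dotE ler_sum // => i _.
rewrite -expr2 -real_normK ?num_real // ler_sqr ?nnegrE //.
rewrite [leRHS]/Num.Def.normr /= mx_normrE.
exact: (le_bigmax _ (fun ij => `|x ij.1 ij.2|) (i, 0)).
Qed.

(* The library norm on columns is the sup norm, for which only a high iterate
   of a Euclidean contraction is contracting. *)
Lemma euclidean_contraction_fixpoint n (T : 'cV[R]_n -> 'cV[R]_n) (q : R) :
  0 <= q < 1 ->
  (forall x y, dot (T x - T y) (T x - T y) <= q * dot (x - y) (x - y)) ->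
  exists w, T w = w.
Proof.
move=> /andP[q0 q1] Tq.
have Tk k x y : dot (iter k T x - iter k T y) (iter k T x - iter k T y)
    <= q ^+ k * dot (x - y) (x - y).
  elim: k => [|k IH]; first by rewrite expr0 mul1r.
  by rewrite (le_trans (Tq _ _)) // exprS -mulrA ler_wpM2l.
(* Passing from the sup norm to the Euclidean norm and back costs a factor [n] on squares, so this
   [k] makes [iter k T] a contraction of ratio [1 / 2] in the sup norm. *)
have [k qk] : exists k, q ^+ k * n%:R <= 1 / 4.
  have : q ^+ k * n%:R @[k --> \oo] --> (0 * n%:R : R).
    by apply: cvgMl; apply: cvg_expr; rewrite ger0_norm.
  rewrite mul0r => /cvgrPdist_le /(_ (1 / 4)) [|K _ /(_ K)]; first by lra.
  rewrite /= leqnn sub0r normrN ger0_norm ?mulr_ge0 ?exprn_ge0 // => /(_ isT).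
  by exists K.
have ctr : is_contraction (totalfun (iter k T) : {fun setT >-> setT}).
  exists (2^-1)%:nng; split => /=; first by lra.
  move=> [x y] _ /=; rewrite -ler_sqr ?nnegrE ?mulr_ge0 ?invr_ge0 //.
  rewrite (le_trans (normr_sqr_le_dot _)) // (le_trans (Tk _ _ _)) //.
  rewrite (le_trans (ler_wpM2l (exprn_ge0 _ q0) (dot_le_normr_sqr _))) //.
  rewrite mulrA exprMn ler_wpM2r ?sqr_ge0 // (le_trans qk) // expr2; lra.
have [w _ wE] := banach_fixed_point ctr closedT (ex_intro _ 0 I).
(* As [T] commutes with its iterates, [T w] is also fixed by [iter k T], and uniqueness gives
   [T w = w]. *)
exists w; apply: (@contraction_fixpoint_unique _ _ _ _ _ _ ctr) => //=.
change (T w = iter k T (T w)); rewrite -iterSr iterS.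
by congr T; exact: wE.
Qed.

(* A strongly monotone Lipschitz operator [G] makes the projected step
   [w |-> P (w - tau G w)] a contraction, for small [tau]. *)
Lemma variational_inequality_solvable n (K : set 'cV[R]_n)
    (P G : 'cV[R]_n -> 'cV[R]_n) (c M : R) :
  (forall x, K (P x)) ->
  (forall x z, K z -> dot (x - P x) (z - P x) <= 0) ->
  0 < c -> 0 < M ->
  (forall x y, c * dot (x - y) (x - y) <= dot (x - y) (G x - G y)) ->
  (forall x y, dot (G x - G y) (G x - G y) <= M * dot (x - y) (x - y)) ->
  exists2 w, K w & forall z, K z -> 0 <= dot (G w) (z - w).
Proof.
move=> KP Pobt c0 M0 Gmono Glip.
(* The obtuse-angle property, used at [x] and at [y], makes the projection nonexpansive. *)
have Pnexp x y : dot (P x - P y) (P x - P y) <= dot (x - y) (x - y).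
  have h1 := Pobt x (P y) (KP y); have h2 := Pobt y (P x) (KP x).
  have h3 : dot (P x - P y) (P x - P y) <= dot (x - y) (P x - P y).
    have -> : dot (x - y) (P x - P y) = dot (P x - P y) (P x - P y)
       - dot (x - P x) (P y - P x) - dot (y - P y) (P x - P y).
      by rewrite !(dotDr, dotDl, dotNr, dotNl); ring.
    lra.
  have := dot_ge0 (x - y - (P x - P y)).
  move: (x - y) (P x - P y) h3 => d p h3.
  rewrite !(dotDr, dotDl, dotNr, dotNl) (dotC p d); lra.
(* Since [tau (M + c^2) = c], the ratio [q] equals [1 - tau c - (tau c)^2 < 1]. It may be negative,
   hence the maximum with [0] below. *)
pose tau := c / (M + c ^+ 2).
have Mc : 0 < M + c ^+ 2 by rewrite addr_gt0 ?exprn_gt0.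
have tau0 : 0 < tau by rewrite divr_gt0.
have tauM : tau * (M + c ^+ 2) = c by rewrite divfK ?gt_eqF.
pose q := 1 - 2 * tau * c + tau ^+ 2 * M.
have [w wE] : exists w, P (w - tau *: G w) = w.
  apply: (@euclidean_contraction_fixpoint _ _ (Num.max 0 q)).
    rewrite le_max lexx gt_max ltr01 /= /q; move: Mc tau0 tauM; rewrite !expr2.
    by clear q; move: tau => t Mc t0 tM; nra.
  move=> x y; rewrite (le_trans (Pnexp _ _)) //.
  have -> : x - tau *: G x - (y - tau *: G y) = x - y - tau *: (G x - G y).
    by rewrite scalerBr !opprD !opprK addrACA.
  have := Gmono x y; have := Glip x y.
  move: (x - y) (G x - G y) => d g gl gm.
  rewrite !(dotDr, dotDl, dotNr, dotNl, dotZr, dotZl) (dotC g d).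
  have := ler_wpM2r (dot_ge0 d) (_ : q <= Num.max 0 q).
  rewrite le_max lexx orbT => /(_ isT); rewrite {1}/q.
  have := ler_wpM2l (sqr_ge0 tau) gl.
  have := ler_wpM2l (ltW tau0) gm; lra.
exists w; first by rewrite -wE.
move=> z Kz; have := Pobt (w - tau *: G w) z Kz.
rewrite wE addrAC subrr add0r dotNl dotZl oppr_le0 pmulr_rge0 //.
Qed.

End FixedPoint.

(** * Existence and uniqueness of the saddle point, and dissipation along the flow *)

Section SaddleOperator.
Variables (R : realType) (n m : nat) (f : 'cV[R]_n -> R).
Variables (A : 'M[R]_(m, n)) (b : 'cV[R]_m).
Variables (mu l sigma kappa eta alpha c : R).
Hypothesis f_low : forall x z,
  f z + dot (grad f z) (x - z) + mu / 2 * dot (x - z) (x - z) <= f x.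
Hypothesis f_up : forall x z,
  f x <= f z + dot (grad f z) (x - z) + l / 2 * dot (x - z) (x - z).
Hypothesis f_lip : lipschitz_grad l f.
Hypothesis AAT_le : loewner_le (A *m A^T) sigma%:M.
Hypothesis kappa_le : loewner_le kappa%:M (A *m A^T).
Hypotheses (mu_ge0 : 0 <= mu) (l_gt0 : 0 < l) (sigma_gt0 : 0 < sigma).
Hypotheses (alpha_gt0 : 0 < alpha) (eta_gt0 : 0 < eta).
Hypothesis eta_alpha : l * alpha <= 2 * eta.
Hypotheses (c_gt0 : 0 < c) (c_le_mu : c <= mu).
Hypothesis c_le_kappa : c <= (2 * eta * alpha - l * alpha ^+ 2) * kappa.

Local Notation gu := (grad_u f A eta alpha).
Local Notation gy := (grad_y f A b eta alpha).

Let mono u (y : 'cV[R]_m) u' (y' : 'cV[R]_m) :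
  c * (dot (u - u') (u - u') + dot (y - y') (y - y')) <=
  dot (u - u') (gu u y - gu u' y') - dot (y - y') (gy u y - gy u' y').
Proof.
exact: (saddle_operator_monotone b f_low f_up kappa_le eta_alpha (ltW alpha_gt0)).
Qed.

Let saddleP us ys := @saddle_pointP R n m f A b mu l eta alpha f_low f_up
  mu_ge0 l_gt0 alpha_gt0 eta_gt0 eta_alpha us ys.

Lemma dot_mul_trmx_le y : dot (A^T *m y) (A^T *m y) <= sigma * dot y y.
Proof.
have := AAT_le y.
by rewrite mulmxBl mul_scalar_mx dotDr dotNr dotZr -mulmxA (dot_mulmxr A) subr_ge0.
Qed.

(** The bound for [A^T] passes to [A]: expand [|A^T A x - sigma x|^2 >= 0], bound [|A^T A x|^2] by
    [sigma |A x|^2], and divide by [sigma]. *)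
Lemma dot_mulmx_le x : dot (A *m x) (A *m x) <= sigma * dot x x.
Proof.
have := dot_mul_trmx_le (A *m x); have := dot_ge0 (A^T *m (A *m x) - sigma *: x).
rewrite (dot_mulmxr A); move: (A^T *m (A *m x)) => v.
rewrite !(dotDr, dotDl, dotNr, dotNl, dotZr, dotZl) (dotC x v) => h1 h2.
by rewrite -(ler_pM2l sigma_gt0); lra.
Qed.

Lemma saddle_operator_lipschitz : exists2 M : R, 0 < M &
  forall u y u' y',
    dot (gu u y - gu u' y') (gu u y - gu u' y')
    + dot (gy u y - gy u' y') (gy u y - gy u' y')
    <= M * (dot (u - u') (u - u') + dot (y - y') (y - y')).
Proof.
(* [C] multiplies [|du - alpha p|^2], where [p = A^T dy], once the gradient increment is bounded by
   its Lipschitz constant; [C1] and [C2] collect the coefficients of [|du|^2] and [|p|^2], and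
   [|p|^2 <= sigma |dy|^2]. *)
pose C := 2 * (1 + alpha ^+ 2 * sigma) * l ^+ 2.
pose C1 := 2 * C + 4 * sigma * eta ^+ 2.
pose C2 := 2 * C * alpha ^+ 2 + 2 * eta ^+ 2 + 16 * sigma * eta ^+ 2 * alpha ^+ 2.
have C_gt0 : 0 < C.
  by rewrite !mulr_gt0 ?exprn_gt0 // addr_gt0 ?mulr_gt0 ?exprn_gt0.
have C1_gt0 : 0 < C1.
  by rewrite addr_gt0 // ?exprn_gt0 //; do ![rewrite mulr_gt0 ?exprn_gt0 //].
have C2_gt0 : 0 < C2.
  by rewrite !addr_gt0 // ?exprn_gt0 //; do ![rewrite mulr_gt0 ?exprn_gt0 //].
exists (C1 + C2 * sigma); first by rewrite addr_gt0 ?mulr_gt0.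
move=> u y u' y'; rewrite grad_uB grad_yB.
have := f_lip (u - alpha *: (A^T *m y)) (u' - alpha *: (A^T *m y')).
have -> : u - alpha *: (A^T *m y) - (u' - alpha *: (A^T *m y'))
  = u - u' - alpha *: (A^T *m (y - y')).
  by rewrite mulmxBr scalerBr opprD opprK addrACA opprB [- _ + _]addrC.
have := dot_mul_trmx_le (y - y').
move: (grad f _ - grad f _) (u - u') (y - y') => dg d e.
set p := A^T *m e => p_le.
rewrite -ler_sqr ?nnegrE ?mulr_ge0 ?norm2_ge0 ?(ltW l_gt0) // exprMn !norm2_sqr.
move=> dg_le.
have h1 := dotDD_le d (- (alpha *: p)).
have h2 := dotDD_le dg (eta *: p).
have h3 := dotDD_le (- alpha *: (A *m dg))
  (A *m (eta *: d - (2 * eta * alpha) *: p)).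
have h4 := dot_mulmx_le (eta *: d - (2 * eta * alpha) *: p).
have h5 := dotDD_le (eta *: d) (- ((2 * eta * alpha) *: p)).
have h6 := dot_mulmx_le dg.
have -> : - alpha *: (A *m dg) + eta *: (A *m d) - (2 * eta * alpha) *: (A *m p)
  = - alpha *: (A *m dg) + A *m (eta *: d - (2 * eta * alpha) *: p).
  by rewrite mulmxBr -!scalemxAr addrA.
rewrite !(dotNl, dotNr, dotZl, dotZr) in h1 h2 h3 h5.
have k1 := ler_wpM2l (sqr_ge0 alpha) h6.
have k2 := ler_wpM2l (ltW sigma_gt0) h5.
have q_ge0 : 0 <= 2 * (1 + alpha ^+ 2 * sigma).
  by rewrite mulr_ge0 // addr_ge0 // mulr_ge0 ?sqr_ge0 // ltW.
have k3 : 2 * (1 + alpha ^+ 2 * sigma) * dot dg dg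
    <= C * dot (d - alpha *: p) (d - alpha *: p).
  by rewrite /C -[leRHS]mulrA ler_wpM2l.
have k4 := ler_wpM2l (ltW C_gt0) h1.
have k5 := ler_wpM2l (ltW C2_gt0) p_le.
have k6 : 0 <= C1 * dot e e by rewrite mulr_ge0 ?dot_ge0 // ltW.
have k7 : 0 <= C2 * sigma * dot d d.
  by rewrite !mulr_ge0 ?dot_ge0 ?(ltW C2_gt0) // ltW.
have : dot (dg + eta *: p) (dg + eta *: p)
  + dot (- alpha *: (A *m dg) + A *m (eta *: d - (2 * eta * alpha) *: p))
      (- alpha *: (A *m dg) + A *m (eta *: d - (2 * eta * alpha) *: p))
  <= C1 * dot d d + C2 * dot p p.
  by rewrite /C1 /C2; lra.
lra.
Qed.

(** Testing each variational inequality at the other solution makes the monotone pairing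
    nonpositive. *)
Lemma saddle_point_unique us ys us' ys' :
  saddle_point (Ltilde f A b eta alpha) us ys ->
  saddle_point (Ltilde f A b eta alpha) us' ys' -> us = us' /\ ys = ys'.
Proof.
move=> /saddleP [ys0 gu0 gy0].
move=> /saddleP [ys0' gu0' gy0'].
have := mono us ys us' ys'; rewrite gu0 gu0' subrr dot0r sub0r.
have := gy0 _ ys0'; have := gy0' _ ys0.
rewrite -(opprB ys ys') => h1; rewrite dotNr => h2.
rewrite (dotC _ (gy us ys - _)) [dot (gy us ys - _) _]dotDl dotNl => h3.
have h : dot (us - us') (us - us') + dot (ys - ys') (ys - ys') <= 0.
  by rewrite -(ler_pM2l c_gt0) mulr0; lra.
have := dot_ge0 (us - us'); have := dot_ge0 (ys - ys') => hy hu.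
by split; apply/eqP; rewrite -subr_eq0; apply/eqP/dot_le0; lra.
Qed.

Lemma saddle_point_exists : exists us ys,
  saddle_point (Ltilde f A b eta alpha) us ys.
Proof.
(* Both variables are stacked in one column; the projection onto [K] takes positive parts of the
   dual block, and the sign of [gy] is flipped to make [G] monotone. *)
pose K := [set w : 'cV[R]_(n + m) | nonneg (dsubmx w)].
pose P (w : 'cV[R]_(n + m)) : 'cV[R]_(n + m) :=
  col_mx (usubmx w) (\col_j Num.max (dsubmx w j 0) 0).
pose G (w : 'cV[R]_(n + m)) : 'cV[R]_(n + m) :=
  col_mx (gu (usubmx w) (dsubmx w)) (- gy (usubmx w) (dsubmx w)).
have [M M0 lip] := saddle_operator_lipschitz.
have dot_sub (w w' : 'cV[R]_(n + m)) : dot (w - w') (w - w') =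
    dot (usubmx w - usubmx w') (usubmx w - usubmx w')
    + dot (dsubmx w - dsubmx w') (dsubmx w - dsubmx w').
  rewrite -{1 2}[w]vsubmxK -{1 2}[w']vsubmxK opp_col_mx add_col_mx.
  by rewrite dot_col_mx.
have [||||||w Kw wVI] := @variational_inequality_solvable R _ K P G c M.
- by move=> w j; rewrite col_mxKd mxE le_max lexx orbT.
- move=> w z Kz; rewrite -{1}[w]vsubmxK -[z]vsubmxK /P.
  rewrite !opp_col_mx !add_col_mx dot_col_mx subrr dot0l add0r.
  rewrite dotE sumr_le0 // => j _; rewrite !mxE; have := Kz j; rewrite !mxE.
  move: (w _ _) (z _ _) => wj zj zj0.
  by case: (ltP wj 0) => wj0; nra.
- by [].
- by [].
- move=> w w'; rewrite dot_sub (le_trans (mono _ _ _ _)) //.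
  rewrite -[w in leRHS]vsubmxK -[w' in leRHS]vsubmxK /G !col_mxKu !col_mxKd.
  by rewrite !opp_col_mx !add_col_mx dot_col_mx -opprD dotNr.
- move=> w w'; rewrite [dot (w - _) _]dot_sub (le_trans _ (lip _ _ _ _)) //.
  rewrite /G opp_col_mx add_col_mx dot_col_mx -opprD dotNr dotNl opprK.
  by [].
exists (usubmx w), (dsubmx w).
apply/saddleP.
split=> //.
(* The primal block is unconstrained, so the test point [u - gu] is admissible and gives
   [|gu|^2 <= 0]. *)
- apply: dot_le0; have := wVI (col_mx (usubmx w - gu (usubmx w) (dsubmx w)) (dsubmx w)).
  rewrite /K /= col_mxKd => /(_ Kw).
  rewrite -[X in _ - X]vsubmxK opp_col_mx add_col_mx dot_col_mx.
  by rewrite subrr dot0r addr0 addrAC subrr add0r dotNr oppr_ge0.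
- move=> y y0; have := wVI (col_mx (usubmx w) y).
  rewrite /K /= col_mxKd => /(_ y0).
  rewrite -[X in _ - X]vsubmxK opp_col_mx add_col_mx dot_col_mx.
  by rewrite subrr dot0r add0r dotNl oppr_ge0.
Qed.

(** The projection changes a component only where [y_j = 0] and [s_j < 0]; there
    [(y_j - ys_j) s_j >= 0] is replaced by [0]. *)
Lemma proj_plus_le (y ys s : 'cV[R]_m) : nonneg y -> nonneg ys ->
  dot (y - ys) (proj_plus y s) <= dot (y - ys) s.
Proof.
move=> y0 ys0; rewrite !dotE ler_sum // => j _; rewrite !mxE.
have := y0 j; have := ys0 j; move: (y _ _) (ys _ _) (s _ _) => yj ysj sj.
move=> ysj0; rewrite le_eqVlt => /predU1P[<-|->//]; rewrite ltxx.
by case: (ltP sj 0) => sj0; nra.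
Qed.

(** The left side is half the derivative of the squared distance to the saddle point along the
    flow. *)
Lemma saddle_flow_dissipation us ys u y :
  saddle_point (Ltilde f A b eta alpha) us ys -> nonneg y ->
  dot (u - us) (- gu u y) + dot (y - ys) (proj_plus y (gy u y))
  <= - c * (dot (u - us) (u - us) + dot (y - ys) (y - ys)).
Proof.
move=> /saddleP [ys0 gu0 gy0] y0.
have := mono u y us ys; rewrite gu0 subr0.
have := gy0 _ y0; have := proj_plus_le (gy u y) y0 ys0.
rewrite [dot (y - ys) (gy u y - gy us ys)]dotDr !dotNr (dotC (gy us ys)); lra.
Qed.

End SaddleOperator.

(** * Absolutely continuous functions, and monotonicity from the sign of the derivative almost
    everywhere *)

Section AbsolutelyContinuous.
Variable R : realType.
Implicit Types (a b : R) (phi psi : R -> R).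

Lemma abs_continuous_le (V W : normedModType R) a b (g : R -> V) (h : R -> W)
    (C : R) :
  0 < C ->
  (forall s t, a <= s -> s <= t -> t <= b -> `|h t - h s| <= C * `|g t - g s|) ->
  abs_continuous a b g -> abs_continuous a b h.
Proof.
move=> C0 hg ac e e0; have [d d0 hd] := ac (e / C) (divr_gt0 e0 C0).
exists d => // s s1 s2 s3; have := hd s s1 s2 s3.
rewrite ltr_pdivlMr // mulrC mulr_sumr; apply: le_lt_trans.
rewrite big_seq [leRHS]big_seq ler_sum // => i /(allP s1)/and3P[? ? ?].
exact: hg.
Qed.

Lemma abs_continuous_cst a b (c : R) : abs_continuous a b (fun _ : R => c : R^o).
Proof.
move=> e e0; exists 1 => // s _ _ _.
by rewrite big1 // => i _; rewrite subrr normr0.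
Qed.

Lemma abs_continuousD a b phi psi :
  abs_continuous a b (phi : R -> R^o) -> abs_continuous a b (psi : R -> R^o) ->
  abs_continuous a b (fun t => phi t + psi t : R^o).
Proof.
move=> ac1 ac2 e e0; have e2 : 0 < e / 2 by rewrite divr_gt0.
have [d1 d10 h1] := ac1 _ e2; have [d2 d20 h2] := ac2 _ e2.
exists (Num.min d1 d2) => [|s s1 s2]; first by rewrite lt_min d10.
rewrite lt_min => /andP[s3 s4].
have := h1 s s1 s2 s3; have := h2 s s1 s2 s4 => h3 h4.
rewrite (le_lt_trans (y := \sum_(i <- s) `|phi i.2 - phi i.1|
   + \sum_(i <- s) `|psi i.2 - psi i.1|)) //; last by lra.
rewrite -big_split ler_sum // => i _ /=.
by rewrite opprD addrACA ler_normD.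
Qed.

Lemma abs_continuous_sum a b (I : Type) (s : seq I) (phi : I -> R -> R) :
  (forall i, abs_continuous a b (phi i : R -> R^o)) ->
  abs_continuous a b (fun t => \sum_(i <- s) phi i t : R^o).
Proof.
move=> ac; elim: s => [|i s IH].
  have -> : (fun t => \sum_(i <- [::]) phi i t : R^o) = (fun=> 0).
    by apply/funext => t; rewrite big_nil.
  exact: abs_continuous_cst.
have -> : (fun t => \sum_(j <- i :: s) phi j t : R^o)
    = (fun t => phi i t + \sum_(j <- s) phi j t).
  by apply/funext => t; rewrite big_cons.
exact: abs_continuousD.
Qed.

(** For the [d] attached to [1], a step shorter than [d] changes [phi] by less than [1]; walk from
    [a] in steps of [d / 2], the predecessor of [t] being clamped at [a]. *)
Lemma abs_continuous_bounded a b phi : abs_continuous a b (phi : R -> R^o) ->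
  exists2 B : R, 0 < B & forall t, a <= t -> t <= b -> `|phi t| <= B.
Proof.
move=> ac; have [d d0 hd] := ac 1 ltr01.
have step (s t : R) : a <= s -> s <= t -> t <= b -> t - s < d ->
    `|phi t - phi s| < 1.
  move=> h1 h2 h3 h4; have := hd [:: (s, t)].
  by rewrite /= !big_seq1 h1 h2 h3 /=; apply.
have near_a k (t : R) : a <= t -> t <= b -> t - a <= k%:R * (d / 2) ->
    `|phi t| <= `|phi a| + k%:R.
  elim: k t => [|k IH] t h1 h2 h3.
    by have -> : t = a by [lra]; rewrite addr0.
  have [ta|ta] := leP (t - a) (k%:R * (d / 2)).
    by rewrite (le_trans (IH _ h1 h2 ta)) // lerD2l ler_nat.
  have kd : 0 <= k%:R * (d / 2) by rewrite mulr_ge0 ?divr_ge0 // ltW.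
  have tda : a <= Num.max a (t - d / 2) by rewrite le_max lexx.
  have htd : t - Num.max a (t - d / 2) < d.
    by case: (ltP a (t - d / 2)) => ?; rewrite -natr1 in h3; lra.
  have htd' : Num.max a (t - d / 2) <= t.
    by rewrite ge_max h1 /=; lra.
  have := step _ _ tda htd' h2 htd.
  have := IH _ tda (le_trans htd' h2).
  have -> : Num.max a (t - d / 2) - a <= k%:R * (d / 2).
    by rewrite -natr1 in h3; case: (ltP a (t - d / 2)) => ?; lra.
  move=> /(_ isT); set x := phi _ => hx hy.
  have : `|phi t| <= `|phi t - x| + `|x|.
    by rewrite -{1}(subrK x (phi t)) ler_normD.
  rewrite -natr1; lra.
pose k := Num.bound ((b - a) / (d / 2)).
exists (`|phi a| + k%:R + 1); first by rewrite ltr_pwDr // addr_ge0.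
move=> t h1 h2; rewrite (le_trans (near_a k t h1 h2 _)) ?lerDl //.
rewrite -ler_pdivrMr ?divr_gt0 //.
have : (t - a) / (d / 2) <= (b - a) / (d / 2).
  by rewrite ler_pM2r ?invr_gt0 ?divr_gt0 // lerB.
have : 0 <= (t - a) / (d / 2) by rewrite divr_ge0 ?divr_ge0 ?subr_ge0 ?(ltW d0).
move=> p1 p2; rewrite (le_trans p2) // ltW // archi_boundP //.
exact: le_trans p1 p2.
Qed.

Lemma abs_continuousM a b phi psi :
  abs_continuous a b (phi : R -> R^o) -> abs_continuous a b (psi : R -> R^o) ->
  abs_continuous a b (fun t => phi t * psi t : R^o).
Proof.
move=> ac1 ac2 e e0.
have [B B0 hB] := abs_continuous_bounded ac1.
have [C C0 hC] := abs_continuous_bounded ac2.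
have [d1 d10 h1] := ac1 _ (divr_gt0 (divr_gt0 e0 C0) (@ltr0n R 2)).
have [d2 d20 h2] := ac2 _ (divr_gt0 (divr_gt0 e0 B0) (@ltr0n R 2)).
exists (Num.min d1 d2) => [|s s1 s2]; first by rewrite lt_min d10.
rewrite lt_min => /andP[s3 s4].
have := h1 s s1 s2 s3; have := h2 s s1 s2 s4.
rewrite -!mulrA -!invfM !ltr_pdivlMr ?mulr_gt0 // => h3 h4.
rewrite (le_lt_trans (y := C * \sum_(i <- s) `|phi i.2 - phi i.1|
   + B * \sum_(i <- s) `|psi i.2 - psi i.1|)) //; last by lra.
rewrite !mulr_sumr -big_split big_seq [leRHS]big_seq.
apply: ler_sum => i /(allP s1)/and3P[i1 i2 i3] /=.
have -> : phi i.2 * psi i.2 - phi i.1 * psi i.1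
  = (phi i.2 - phi i.1) * psi i.2 + phi i.1 * (psi i.2 - psi i.1) by ring.
rewrite (le_trans (ler_normD _ _)) // !normrM [C * _]mulrC.
rewrite lerD // ?ler_wpM2l ?ler_wpM2r // ?hB ?hC //.
  exact: le_trans i1 i2.
exact: le_trans i2 i3.
Qed.

Lemma abs_continuous_expR (k a b : R) : 0 <= k ->
  abs_continuous a b (fun t => expR (k * t) : R^o).
Proof.
move=> k0.
have id_ac : abs_continuous a b (id : R -> R^o).
  move=> e e0; exists e => // s s1 _; apply: le_lt_trans.
  rewrite big_seq [leRHS]big_seq ler_sum // => i /(allP s1)/and3P[_ i2 _].
  by rewrite ger0_norm ?subr_ge0.
(* Up to [b], [expR (k t)] has Lipschitz constant [k expR (k b)]; the added [1] keeps [C] positive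
   when [k = 0]. *)
apply: (abs_continuous_le (C := expR (k * b) * k + 1) _ _ id_ac).
  by rewrite ltr_pwDr // mulr_ge0 ?expR_ge0.
move=> s t a_s st tb; rewrite !ger0_norm ?subr_ge0 ?ler_expR ?ler_wpM2l //.
have := expR_ge1Dx (k * s - k * t).
rewrite expRB ler_pdivlMr ?expR_gt0 // => h.
have hb : expR (k * t) <= expR (k * b) by rewrite ler_expR ler_wpM2l.
have : expR (k * t) * (k * (t - s)) <= expR (k * b) * (k * (t - s)).
  by rewrite ler_wpM2r // mulr_ge0 ?subr_ge0.
lra.
Qed.

Lemma abs_continuous_dot n (a b : R) (u : R -> 'cV[R]_n) (us : 'cV[R]_n) :
  abs_continuous a b u ->
  abs_continuous a b (fun t => dot (u t - us) (u t - us) : R^o).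
Proof.
move=> ac.
have -> : (fun t => dot (u t - us) (u t - us) : R^o)
    = (fun t => \sum_i (u t i 0 - us i 0) * (u t i 0 - us i 0) : R^o).
  by apply/funext => t; rewrite dotE; apply: eq_bigr => i _; rewrite !mxE.
apply: abs_continuous_sum => i.
have aci : abs_continuous a b (fun t => u t i 0 - us i 0 : R^o).
  apply: (abs_continuous_le (C := 1) _ _ ac) => // s' t _ _ _.
  have -> : u t i 0 - us i 0 - (u s' i 0 - us i 0) = u t i 0 - u s' i 0 by ring.
  rewrite mul1r.
  rewrite [leRHS]/Num.Def.normr /= mx_normrE.
  have := le_bigmax 0 (fun ij => `|(u t - u s') ij.1 ij.2|) (i, 0).
  by rewrite !mxE.
exact: abs_continuousM.
Qed.

Lemma negligible_cover (N : set R) (e : R) : lebesgue_measure.-negligible N ->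
  0 < e -> exists U : set R, [/\ open U, N `<=` U & (lebesgue_measure U < e%:E)%E].
Proof.
move=> [B [mB B0 NB]] e0.
have Boo : (lebesgue_measure B < +oo)%E. by rewrite B0.
have [U [oU BU Ue]] := @lebesgue_regularity_outer R B e mB Boo e0.
exists U; split=> //; first exact: subset_trans BU.
have mU : measurable U by exact: measurable_realfun.open_measurable.
rewrite (_ : U = B `|` (U `\` B)); last first.
  apply/seteqP; split=> [x Ux|x [/BU//|[]//]].
  by have [Bx|nBx] := pselect (B x); [left|right].
apply: (@le_lt_trans _ _ (lebesgue_measure B + lebesgue_measure (U `\` B))%E).
  by apply: measureU2 => //; exact: measurableD.
by rewrite B0 add0e.
Qed.

(* Real induction over [s] along [a, b]: near a point of the null set [N] the
   increment of [phi] is charged to an interval inside a small open cover of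
   [N], elsewhere to the slope [e]. *)
Lemma abs_continuous_nonincreasing a b phi (N : set R) : a <= b ->
  abs_continuous a b (phi : R -> R^o) -> lebesgue_measure.-negligible N ->
  (forall t, a < t < b -> ~ N t -> exists2 d : R, d <= 0 & is_derive t (1 : R) phi d) ->
  phi b <= phi a.
Proof.
move=> ab ac N0 dphi.
(* The budget is slope [e] over the length [b - a], plus [e] for the total increment over the
   cover. *)
suff main e : 0 < e -> phi b <= phi a + e * (b - a + 1).
  rewrite leNgt; apply/negP => phab.
  have h0 : 0 < (phi b - phi a) / (2 * (b - a + 1)).
    by rewrite divr_gt0 ?subr_gt0 // mulr_gt0 //; lra.
  have := main _ h0.
  have -> : (phi b - phi a) / (2 * (b - a + 1)) * (b - a + 1) = (phi b - phi a) / 2.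
    by field; apply/eqP; lra.
  lra.
move=> e0; have [d d0 hd] := ac e e0.
have set1_negligible (x : R) : lebesgue_measure.-negligible [set x].
  by apply/negligibleP => //; exact: lebesgue_measure_set1.
(* The endpoints join the null set because derivatives are given only inside []a, b[]. *)
have [U [oU NU Ud]] := negligible_cover
  (negligibleU N0 (negligibleU (set1_negligible a) (set1_negligible b))) d0.
have mU : measurable U by exact: measurable_realfun.open_measurable.
pose Q s := exists l : seq (R * R),
  [/\ all (fun i => [&& a <= i.1, i.1 <= i.2 & i.2 <= s]) l,
      pairwise (fun i j => (i.2 <= j.1) || (j.2 <= i.1)) l,
      ((\sum_(i <- l) (i.2 - i.1))%:E <= lebesgue_measure (U `&` `[a, s]%classic))%E &
      phi s <= phi a + e * (s - a) + \sum_(i <- l) `|phi i.2 - phi i.1|].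
have Qslope s t : s <= t -> phi t - phi s <= e * (t - s) -> Q s -> Q t.
  move=> st slope [l [l1 l2 l3 l4]]; exists l; split=> //.
  - by apply: sub_all l1 => i /and3P[-> ->] /= /le_trans; apply.
  - apply: (le_trans l3); apply: le_measure; rewrite ?inE.
    + exact: measurableI.
    + exact: measurableI.
    + by apply: setIS => x /=; rewrite !in_itv /= => /andP[-> /le_trans]; apply.
  - lra.
have Qcover s t : a <= s -> s <= t -> `[s, t]%classic `<=` U -> Q s -> Q t.
  move=> sa st stU [l [l1 l2 l3 l4]]; exists ((s, t) :: l); split=> /=.
  - rewrite sa st lexx /=.
    by apply: sub_all l1 => i /and3P[-> ->] /= /le_trans; apply.
  - rewrite l2 andbT; apply: sub_all l1 => i /and3P[_ _ ->].
    by rewrite orbT.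
  - rewrite big_cons /= EFinD addeC.
    have -> : (t - s)%:E = lebesgue_measure (`]s, t]%classic : set R).
      rewrite lebesgue_measure_itv /= lte_fin.
      by move: st; rewrite le_eqVlt => /predU1P[->|->//]; rewrite ltxx subrr.
    rewrite (le_trans (leeD2r _ l3)) // -measureU //.
    + apply: le_measure; rewrite ?inE //.
        apply: measurableU => //; exact: measurableI.
        exact: measurableI.
      move=> x /= [[Ux]|]; rewrite !in_itv /=.
        by move=> /andP[ax xs]; rewrite ax (le_trans xs st).
      move=> /andP[sx xt]; rewrite xt (le_trans sa (ltW sx)); split => //.
      by apply: stU; rewrite /= in_itv /= xt ltW.
    + exact: measurableI.
    + rewrite -subset0 => x /= [[_]]; rewrite !in_itv /= => /andP[_ xs] /andP[sx _].
      by move: (lt_le_trans sx xs); rewrite ltxx.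
  - rewrite big_cons /=.
    have := ler_norm (phi t - phi s).
    have : 0 <= e * (t - s) by rewrite mulr_ge0 ?subr_ge0 // ltW.
    lra.
(* Locally [Q] propagates from the left up to [s] and from [s] to the right: through [U] by adding
   an interval, elsewhere because [d' <= 0] keeps difference quotients at [s] below [e]. *)
have Qlocal s : a <= s <= b -> exists2 r : R, 0 < r & forall s1 s2,
    s - r < s1 -> s1 <= s -> s <= s2 -> s2 < s + r -> a <= s1 -> s2 <= b ->
    (Q s1 -> Q s) /\ (Q s -> Q s2).
  move=> /andP[as_ sb]; have [Us|nUs] := pselect (U s).
    have /nbhs_ballP[r /= r0 rU] : nbhs s U by exact: open_nbhs_nbhs.
    exists r => // s1 s2 h1 h2 h3 h4 h5 h6.
    by split; apply: Qcover => // x; rewrite /= in_itv /= => /andP[x1 x2];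
      apply: rU; rewrite /ball /= ltr_distlC; apply/andP; split; lra.
  have sa : s != a by apply/eqP => E; apply: nUs; apply: NU; right; left.
  have sb' : b != s by apply/eqP => E; apply: nUs; apply: NU; right; right.
  have [||d' d'0 [dd dE]] := dphi s.
  - by rewrite !lt_neqAle eq_sym sa as_ eq_sym sb' sb.
  - by move=> Ns; apply: nUs; apply: NU; left.
  have dcvg : h^-1 *: (phi (h *: (1 : R) + s) - phi s) @[h --> 0^'] --> d'.
    by rewrite -dE; exact: dd.
  move/cvgrPdist_lt : dcvg => /(_ e e0)[r /= r0 hr].
  have slope h : `|h| < r -> h != 0 -> h^-1 * (phi (h + s) - phi s) <= e.
    move=> hr' h0; have := hr h; rewrite /ball /= sub0r normrN => /(_ hr' h0).
    rewrite /GRing.scale /= mulr1 ltr_distl => /andP[+ _]; lra.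
  exists r => // s1 s2 h1 h2 h3 h4 h5 h6; split; apply: Qslope => //.
    move: h2; rewrite le_eqVlt => /predU1P[->|s1s]; first by rewrite !subrr mulr0.
    have := slope (s1 - s); rewrite subrK ltr0_norm ?subr_lt0 // opprB subr_eq0.
    rewrite lt_eqF // => /(_ _ isT); rewrite ler_ndivrMl ?subr_lt0 // => H.
    have : s - s1 < r by lra.
    by move/H; lra.
  move: h3; rewrite le_eqVlt => /predU1P[->|s1s]; first by rewrite !subrr mulr0.
  have := slope (s2 - s); rewrite subrK gtr0_norm ?subr_gt0 // subr_eq0.
  rewrite gt_eqF // => /(_ _ isT); rewrite ler_pdivrMl ?subr_gt0 // => H.
  have : s2 - s < r by lra.
  by move/H; lra.
pose S := [set s | a <= s <= b /\ Q s].
have Qa : Q a.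
  exists [::]; split=> //=; rewrite ?big_nil ?measure_ge0 //; lra.
have supS : has_sup S.
  by split; [exists a; rewrite /S /= lexx ab|exists b => s [/andP[]]].
have Sa : S a by rewrite /S /= lexx ab.
have as_ : a <= sup S by apply: ub_le_sup => //; case: supS.
have sb : sup S <= b by apply: ge_sup => [|s [/andP[]//]]; exists a.
have asb : a <= sup S <= b by rewrite as_.
have [r r0 hr] := Qlocal _ asb.
have [s [/andP[s1 s2] Qs] srs] := sup_adherent r0 supS.
have ss : s <= sup S by apply: ub_le_sup; [case: supS|split => //; rewrite s1].
(* The left half of [Qlocal] carries [Q] to the supremum; the right half would pass beyond it if it
   were less than [b]. *)
have Qsup : Q (sup S).
  have [||||||+ _] := hr s (sup S) => //; last exact.
  by rewrite ltrDl.
have supSb : sup S = b.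
  apply/eqP; rewrite eq_le sb leNgt; apply/negP => sltb.
  pose t := Num.min b (sup S + r / 2).
  have st : sup S < t by rewrite lt_min sltb ltrDl divr_gt0.
  have Qt : Q t.
    have [||||||_] := hr (sup S) t => //; last exact.
    - by rewrite ltrBlDr ltrDl.
    - exact: ltW.
    - by rewrite gt_min; apply/orP; right; lra.
    - by rewrite ge_min lexx.
  have : t <= sup S.
    apply: ub_le_sup; first by case: supS.
    by split=> //; rewrite (le_trans as_ (ltW st)) ge_min lexx.
  by rewrite leNgt st.
rewrite supSb in Qsup; have [l [l1 l2 l3 l4]] := Qsup.
have : \sum_(i <- l) `|phi i.2 - phi i.1| < e.
  apply: hd l1 l2 _; rewrite -lte_fin (le_lt_trans l3) //.
  apply: le_lt_trans Ud; apply: le_measure; rewrite ?inE //.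
  exact: measurableI.
lra.
Qed.

End AbsolutelyContinuous.

(** * Exponential decay of the squared distance to the saddle point *)

Lemma is_derive_dist_sqr (R : realType) n (g : R -> 'cV[R]_n) (dg w : 'cV[R]_n)
    (t : R) : is_derive t (1 : R) g dg ->
  is_derive t (1 : R) (fun s => dot (g s - w) (g s - w) : R) (2 * dot (g t - w) dg).
Proof.
move=> [g_der gE].
have coord i : is_derive t (1 : R) (fun s => g s i 0) (dg i 0).
  split; first exact: (derivable_mxP _ _ _).1.
  by rewrite -gE derive_mx // mxE.
have -> : (fun s => dot (g s - w) (g s - w) : R)
    = \sum_(i < n) (fun s => (g s i 0 - w i 0) * (g s i 0 - w i 0)).
  apply/funext => s; rewrite fct_sumE dotE.
  by apply: eq_bigr => i _; rewrite !mxE.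
have -> : 2 * dot (g t - w) dg
    = \sum_(i < n) ((g t i 0 - w i 0) * dg i 0 + (g t i 0 - w i 0) * dg i 0).
  rewrite dotE mulr_sumr; apply: eq_bigr => i _; rewrite !mxE; ring.
apply: is_derive_sum => i; have := coord i => di.
by apply: is_derive_eq; rewrite subr0 /GRing.scale.
Qed.

Theorem mainTheorem18 (R : realType) (n m : nat) (f : 'cV[R]_n -> R)
    (A : 'M[R]_(m, n)) (b : 'cV[R]_m) (mu l sigma kappa eta alpha : R)
    (f_C1 : C1 f) (f_convex : convex f)
    (mu_gt0 : 0 < mu) (l_gt0 : 0 < l) (sigma_gt0 : 0 < sigma)
    (kappa_gt0 : 0 < kappa)
    (f_strongly_convex : strongly_convex mu f)
    (f_lipschitz_grad : lipschitz_grad l f)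
    (A_full_row_rank : row_free A)
    (AAT_le_sigma : loewner_le (A *m A^T) sigma%:M)
    (kappa_le_AAT : loewner_le kappa%:M (A *m A^T))
    (eta_gt0 : 0 < eta) (alpha_gt0 : 0 < alpha)
    (eta_alpha : l * alpha < 2 * eta) :
  let c := Num.min mu ((2 * eta * alpha - l * alpha ^+ 2) * kappa) in
  let L := Ltilde f A b eta alpha in
  [/\ 0 < c,
      exists! ws : 'cV[R]_n * 'cV[R]_m, saddle_point L ws.1 ws.2
    & forall (us : 'cV[R]_n) (ys : 'cV[R]_m), saddle_point L us ys ->
      forall (u : R -> 'cV[R]_n) (y : R -> 'cV[R]_m),
        is_solution f A b eta alpha u y ->
      forall t : R, 0 <= t ->
        norm2 (col_mx (u t) (y t) - col_mx us ys)
        <= norm2 (col_mx (u 0) (y 0) - col_mx us ys) * expR (- c * t)].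
Proof.
move=> c L.
have eta_alpha_le := ltW eta_alpha.
have gap_gt0 : 0 < 2 * eta * alpha - l * alpha ^+ 2.
  by rewrite subr_gt0 expr2 mulrA ltr_pM2r.
have c_gt0 : 0 < c by rewrite lt_min mu_gt0 mulr_gt0.
have c_le_mu : c <= mu by rewrite ge_min lexx.
have c_le_kappa : c <= (2 * eta * alpha - l * alpha ^+ 2) * kappa.
  by rewrite ge_min lexx orbT.
have f_diff := f_C1.1.
have f_low := strongly_convex_grad f_diff f_strongly_convex.
have f_up := descent f_diff f_lipschitz_grad.
split=> //.
  have [us [ys sad]] := @saddle_point_exists R n m f A b mu l sigma kappa eta alpha c
    f_low f_up f_lipschitz_grad AAT_le_sigma kappa_le_AAT (ltW mu_gt0) l_gt0
    sigma_gt0 alpha_gt0 eta_gt0 eta_alpha_le c_gt0 c_le_mu c_le_kappa.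
  exists (us, ys); split=> // -[us' ys'] /= sad'.
  have [-> ->] := @saddle_point_unique R n m f A b mu l kappa eta alpha c
    f_low f_up kappa_le_AAT (ltW mu_gt0) l_gt0
    alpha_gt0 eta_gt0 eta_alpha_le c_gt0 c_le_mu c_le_kappa _ _ _ _ sad sad'.
  by [].
move=> us ys sad u y [ac y_ge0 ode] t t_ge0.
pose V (s : R) := dot (u s - us) (u s - us) + dot (y s - ys) (y s - ys).
have distE s : norm2 (col_mx (u s) (y s) - col_mx us ys) = Num.sqrt (V s).
  by rewrite /norm2 opp_col_mx add_col_mx dot_col_mx.
have V_ge0 s : 0 <= V s by rewrite addr_ge0 ?dot_ge0.
have V_decay : expR (2 * c * t) * V t <= V 0.
  (* Absolute continuity is available on [[0, T]] with [T > 0] only, so [t = 0] is separate. *)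
  move: t_ge0; rewrite le_eqVlt => /predU1P[<-|t_gt0].
    by rewrite mulr0 expR0 mul1r.
  have [ac_u ac_y] := ac _ t_gt0.
  pose phi (s : R) := expR (2 * c * s) * V s.
  have -> : V 0 = phi 0 by rewrite /phi mulr0 expR0 mul1r.
  have ac_phi : abs_continuous 0 t (phi : R -> R^o).
    apply: abs_continuousM.
      by apply: abs_continuous_expR; rewrite mulr_ge0 ?ltW.
    by apply: abs_continuousD; exact: abs_continuous_dot.
  (* The exceptional null set is the complement of the property in [ode], so being outside it is a
     double negation of the differential equations. *)
  apply: (abs_continuous_nonincreasing (ltW t_gt0) ac_phi ode).
  move=> s /andP[s_gt0 _] /contrapT /(_ s_gt0) [du dy].
  have dV := is_deriveD (is_derive_dist_sqr us du) (is_derive_dist_sqr ys dy).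
  have dE : is_derive s (1 : R) (fun s => expR (2 * c * s)) (2 * c * expR (2 * c * s)).
    have dlin : is_derive s (1 : R) (fun r => 2 * c * r) (2 * c).
      by apply: is_derive_eq; rewrite /GRing.scale /= mulr1.
    exact: (is_derive_eq (is_derive1_comp (is_derive_expR _) dlin) (mulrC _ _)).
  eexists; last exact: is_deriveM dE dV.
  have := saddle_flow_dissipation f_low f_up kappa_le_AAT (ltW mu_gt0) l_gt0
    alpha_gt0 eta_gt0 eta_alpha_le c_le_mu c_le_kappa (u s) sad (y_ge0 s (ltW s_gt0)).
  rewrite /grad_u /grad_y opprD -/(V s).
  set p := dot _ (- _ - _); set q := dot _ (proj_plus _ _) => diss.
  rewrite /GRing.scale /= -[X in _ + X * _]/(V s).
  (* Dissipation reads [p + q <= - c V], so the factored derivative is nonpositive. *)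
  have -> : expR (2 * c * s) * (2 * p + 2 * q) + V s * (2 * c * expR (2 * c * s))
    = 2 * expR (2 * c * s) * (p + q + c * V s) by ring.
  by rewrite mulr_ge0_le0 ?mulr_ge0 ?expR_ge0 //; lra.
rewrite !distE -(@ler_sqr R) ?nnegrE ?mulr_ge0 ?sqrtr_ge0 ?expR_ge0 //.
rewrite exprMn !sqr_sqrtr // -expRM_natl.
rewrite (_ : 2 * (- c * t) = - (2 * c * t)); last by ring.
by rewrite expRN ler_pdivlMr ?expR_gt0 // mulrC.
Qed.
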